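(* Let $M$ be a $4$-dimensional Riemannian manifold with a metric $g$ and an affinor structure (i.e. a $(1,1)$-tensor field) $q$ whose components in the local coordinate system $(x^1,x^2,x^3,x^4)$ are $$(g_{ij})=\begin{pmatrix} A & B & C & B\\ B & A & B & C\\ C & B & A & B\\ B & C & B & A\end{pmatrix},\qquad (q_i^{.j})=\begin{pmatrix} 0&1&0&0\\0&0&1&0\\0&0&0&1\\1&0&0&0\end{pmatrix},$$ where $A,B,C$ are smooth functions with $A>C>B>0$. Then $$q^4=E,\qquad q^2\neq \pm E,$$ and $$g(qu,qv)=g(u,v)\qquad\text{for all vector fields } u,v\in\chi M.$$
   Context: The coordinates $(x^1,x^2,x^3,x^4)$ range over an open set $F\subset\mathbb{R}^4$, and $A,B,C$ are smooth real-valued functions of the point $p=(x^1,x^2,x^3,x^4)\in F$; all assertions are understood on this coordinate domain. The condition $A>C>B>0$ ensures that $g$ is positive definite. In $q_i^{.j}$ the lower index $i$ is the row index and the upper index $j$ is the column index, so $q$ acts on vector fields by $(qu)^j=\sum_i q_i^{.j}u^i$. $\chi M$ denotes the smooth vector fields on $M$ and $E$ is the identity (unit matrix). *)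

(* Defs.v *)
From HB Require Import structures.
From mathcomp Require Import all_boot all_order all_algebra.
From mathcomp Require Import all_classical all_reals all_analysis.

Set Implicit Arguments.
Unset Strict Implicit.
Unset Printing Implicit Defensive.

Import Order.TTheory GRing.Theory Num.Theory.
Import numFieldNormedType.Exports.

Local Open Scope classical_set_scope.
Local Open Scope ring_scope.

(* Fields over a coordinate domain F are represented by total functions on R^n.
   Their values outside F are irrelevant: every condition below is imposed at
   points of F only, and F is open wherever these conditions are used, so that
   continuity and derivatives at points of F depend only on the values on F. *)

(* The partial derivatives of f of order at most k exist and are continuous. *)
Fixpoint Ck_on (R : realType) (n k : nat) (F : set 'rV[R]_n.+1)
    (f : 'rV[R]_n.+1 -> R) : Prop :=
  (forall p, F p -> {for p, continuous f}) /\
  match k with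
  | 0 => True
  | k'.+1 => forall i : 'I_n.+1,
      (forall p, F p -> derivable f p (delta_mx 0 i)) /\
      Ck_on k' F (fun p => 'D_(delta_mx 0 i) f p)
  end.

Definition smooth_on (R : realType) (n : nat) (F : set 'rV[R]_n.+1)
    (f : 'rV[R]_n.+1 -> R) : Prop :=
  forall k, Ck_on k F f.

Definition smooth_mx_on (R : realType) (n a b : nat) (F : set 'rV[R]_n.+1)
    (T : 'rV[R]_n.+1 -> 'M[R]_(a, b)) : Prop :=
  forall i j, smooth_on F (fun p => T p i j).

(* Vector fields are given by their rows of components (u^1, ..., u^n). *)
Definition vector_field (R : realType) (n : nat) (F : set 'rV[R]_n.+1)
    (u : 'rV[R]_n.+1 -> 'rV[R]_n.+1) : Prop :=
  smooth_mx_on F u.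

(* Row index = lower index, column index = upper index. *)
Definition affinor (R : realType) (n : nat) (F : set 'rV[R]_n.+1)
    (q : 'rV[R]_n.+1 -> 'M[R]_n.+1) : Prop :=
  smooth_mx_on F q.

Definition riemannian_metric (R : realType) (n : nat) (F : set 'rV[R]_n.+1)
    (g : 'rV[R]_n.+1 -> 'M[R]_n.+1) : Prop :=
  smooth_mx_on F g /\
  (forall p, F p ->
     (g p)^T = g p /\
     forall x : 'rV[R]_n.+1, x != 0 -> 0 < (x *m g p *m x^T) 0 0).

(* (qu)^j = \sum_i q_i^j u^i *)
Definition affinor_act (R : realType) (n : nat)
    (q : 'rV[R]_n.+1 -> 'M[R]_n.+1) (u : 'rV[R]_n.+1 -> 'rV[R]_n.+1)
    : 'rV[R]_n.+1 -> 'rV[R]_n.+1 :=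
  fun p => u p *m q p.

(* g(u, v) = \sum_(i, j) g_ij u^i v^j *)
Definition metric_eval (R : realType) (n : nat)
    (g : 'rV[R]_n.+1 -> 'M[R]_n.+1) (u v : 'rV[R]_n.+1 -> 'rV[R]_n.+1)
    : 'rV[R]_n.+1 -> R :=
  fun p => (u p *m g p *m (v p)^T) 0 0.

Definition mx4_of_rows (R : realType) (s : seq (seq R)) : 'M[R]_4 :=
  \matrix_(i < 4, j < 4) nth 0 (nth [::] s i) j.

Definition g_components (R : realType) (A B C : R) : 'M[R]_4 :=
  mx4_of_rows [:: [:: A; B; C; B];
                  [:: B; A; B; C];
                  [:: C; B; A; B];
                  [:: B; C; B; A]].

Definition q_components (R : realType) : 'M[R]_4 :=
  mx4_of_rows [:: [:: 0; 1; 0; 0];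
                  [:: 0; 0; 1; 0];
                  [:: 0; 0; 0; 1];
                  [:: 1; 0; 0; 0]].

(* Main.v *)
(* q is the matrix of the cyclic shift i |-> i + 1 of Z/4, and g is circulant:
   its entries depend only on the difference of their indices, so that
   q g q^T, which has entries g_(i+1)(j+1), is g. *)

Require Import Defs.
From HB Require Import structures.
From mathcomp Require Import all_boot all_order all_algebra.
From mathcomp Require Import all_classical all_reals all_analysis.
Import Order.TTheory GRing.Theory Num.Theory.
Import numFieldNormedType.Exports.
Local Open Scope classical_set_scope.
Local Open Scope ring_scope.

(* The addition in [i + 1] is that of Z/4. *)
Lemma mul_q_componentsE (R : realType) n (M : 'M[R]_(4, n)) (i : 'I_4) j :
  (q_components R *m M) i j = M (i + 1) j.
Proof.
(* Row [i] of [q] has its only nonzero entry in column [i + 1], so one term of the sum survives. *)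
rewrite mxE (bigD1 (i + 1)) //= big1 => [|k nek]; rewrite !mxE.
  by rewrite addr0; case: i => [[|[|[|[|?]]]] ?] //=; rewrite mul1r.
by case: i k nek => [[|[|[|[|?]]]] ?] [[|[|[|[|?]]]] ?] //= _; rewrite mul0r.
Qed.

Lemma q_componentsX4 (R : realType) : q_components R ^+ 4 = 1%:M.
Proof.
apply/matrixP => i j; rewrite -[_ ^+ 4]mulr1 !exprS expr0 !mulr1.
(* A final factor 1 is restored, so that all four copies of [q] act as shifts on the rows of the
   unit matrix. *)
rewrite -[X in _ * (_ * (_ * X))]mulr1 !mul_q_componentsE.
by congr (1%:M _ _); apply/val_inj; case: i => [[|[|[|[|?]]]] ?].
Qed.

(** Both E and -E vanish at this off-diagonal position, so this single entry separates [q ^+ 2] from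
    each of them. *)
Lemma q_componentsX2_02 (R : realType) : (q_components R ^+ 2) 0 2%:R = 1.
Proof. by rewrite expr2 mul_q_componentsE mxE. Qed.

Lemma g_components_shift (R : realType) (A B C : R) (i j : 'I_4) :
  g_components A B C (i + 1) (j + 1) = g_components A B C i j.
Proof.
by rewrite !mxE; case: i j => [[|[|[|[|?]]]] ?] [[|[|[|[|?]]]] ?].
Qed.

(** With vectors as rows, g(qu, qv) is u q g q^T v^T, so this identity is the pointwise invariance
    of g. *)
Lemma q_components_isometry (R : realType) (A B C : R) :
  q_components R *m g_components A B C *m (q_components R)^T
  = g_components A B C.
Proof.
apply/matrixP => i j.
(* Transposing turns the right factor q^T into a left factor q, so the row shift rule also handles
   the columns. *)
rewrite -mulmxA mul_q_componentsE -[_ *m _]trmxK mxE trmx_mul trmxK.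
by rewrite mul_q_componentsE mxE g_components_shift.
Qed.

Theorem theorem3p1 (R : realType) (F : set 'rV[R]_4) (A B C : 'rV[R]_4 -> R)
    (g q : 'rV[R]_4 -> 'M[R]_4)
    (hF : open F)
    (hA : smooth_on F A) (hB : smooth_on F B) (hC : smooth_on F C)
    (hABC : forall p, F p -> A p > C p /\ C p > B p /\ B p > 0)
    (hg : riemannian_metric F g)
    (hgE : forall p, F p -> g p = g_components (A p) (B p) (C p))
    (hq : affinor F q)
    (hqE : forall p, F p -> q p = q_components R) :
  (forall p, F p -> q p ^+ 4 = 1%:M) /\
  (forall p, F p -> q p ^+ 2 <> 1%:M /\ q p ^+ 2 <> - 1%:M) /\
  (forall u v : 'rV[R]_4 -> 'rV[R]_4, vector_field F u -> vector_field F v ->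
     forall p, F p ->
       metric_eval g (affinor_act q u) (affinor_act q v) p
       = metric_eval g u v p).
Proof.
split=> [p Fp|]; first by rewrite hqE// q_componentsX4.
split=> [p Fp|u v _ _ p Fp].
  by rewrite hqE//; split=> /matrixP/(_ 0 2%:R)/eqP;
    rewrite q_componentsX2_02 !mxE ?mulr0n ?oppr0 oner_eq0.
rewrite /metric_eval /affinor_act hqE// hgE// trmx_mul !mulmxA.
(* Reassociating twice isolates the block q g q^T between u and v^T. *)
by rewrite -(mulmxA (u p)) -(mulmxA (u p)) q_components_isometry.
Qed.
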